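(* Let $\Delta=\bigsqcup_{i\in\mathbb Z}\Delta(i)$ be a $\mathbb Z$-grading of an irreducible reduced crystallographic root system with compatible positive system, simple roots $\Pi$ and Weyl group $W$. Then $$W^0_{\max}=\{w\in W^0\mid w^{-1}(\alpha)\in\Delta(\le 1)\ \text{for all }\alpha\in\Pi\},$$ where $\Delta(\le 1)=\bigsqcup_{j\le 1}\Delta(j)$.
   Context: A $\mathbb Z$-grading: $\Delta=\bigsqcup_i\Delta(i)$ with $\gamma_1+\gamma_2\in\Delta(i_1+i_2)$ whenever $\gamma_j\in\Delta(i_j)$ and $\gamma_1+\gamma_2\in\Delta$; compatibility: $\Delta^+=\Delta(0)^+\sqcup\bigsqcup_{i\ge1}\Delta(i)$ with $\Delta(0)^+$ a positive system of $\Delta(0)$; $\Delta(\ge1)=\bigsqcup_{j\ge1}\Delta(j)$. Order: $\mu\preccurlyeq\gamma$ iff $\gamma-\mu$ is a nonnegative integer combination of simple roots; lower ideals of $\Delta(1)$ are its downward closed subsets; $I^c=\Delta(1)\setminus I$. $N(w)=\{\gamma\in\Delta^+\mid w(\gamma)\in-\Delta^+\}$. $W^0=\{w\in W\mid w(\alpha)\in\Delta^+\ \forall\alpha\in\Delta(0)^+\}$. For $J\subset\Delta^+$: $J^1=J$, $J^k=(J+J^{k-1})\cap\Delta$, $\langle J\rangle=\bigcup_{k\ge1}J^k$. For a lower ideal $I$ of $\Delta(1)$, $w_{I,\max}$ is the unique $w\in W$ with $N(w)=\Delta(\ge1)\setminus\langle I^c\rangle$ (equivalently, the unique element of maximal length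 among $w\in W^0$ with $N(w)\cap\Delta(1)=I$). $W^0_{\max}=\{w_{I,\max}\mid I\text{ a lower ideal of }\Delta(1)\}$. *)

(* Defs.v *)
From HB Require Import structures.
From mathcomp Require Import all_boot all_order all_algebra.
From mathcomp Require Import mathcomp_extra boolp classical_sets functions cardinality.

Set Implicit Arguments.
Unset Strict Implicit.
Unset Printing Implicit Defensive.

Import Order.TTheory GRing.Theory Num.Theory.

Local Open Scope classical_set_scope.
Local Open Scope ring_scope.

(* The ambient Euclidean space is a finite-dimensional space V over an ordered *)
(* field R (the real numbers being one instance) with an inner product f.      *)

Section RootSystems.
Variables (R : realFieldType) (V : vectType R) (f : {dot V for idfun}).

Definition refl_fun (a v : V) : V := v - (2 * f v a / f a a) *: a.

Lemma refl_fun_is_linear a : linear (refl_fun a).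
Proof.
move=> k u v; rewrite /refl_fun linearPl /= mulrDr mulrDl scalerDl scalerBr.
by rewrite opprD addrACA scalerA mulrCA !mulrA.
Qed.

HB.instance Definition _ a :=
  GRing.isLinear.Build R V V *:%R (refl_fun a) (refl_fun_is_linear a).

Definition refl (a : V) : 'End(V) := linfun (refl_fun a).

Lemma reflE a v : refl a v = v - (2 * f v a / f a a) *: a.
Proof. by rewrite /refl lfunE. Qed.

Definition is_root_system (D : set V) : Prop :=
  [/\ finite_set D,
      ~ D 0,
      forall U : {vspace V}, (forall a, D a -> a \in U) -> U = fullv,
      forall a b, D a -> D b -> D (refl a b)
    & forall a b, D a -> D b -> exists m : int, 2 * f b a / f a a = m%:~R].

Definition is_reduced (D : set V) : Prop :=
  forall (a : V) (c : R), D a -> D (c *: a) -> c = 1 \/ c = -1.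

Definition is_irreducible (D : set V) : Prop :=
  D !=set0 /\
  forall A B : set V, D = A `|` B ->
    (forall a b, A a -> B b -> f a b = 0) -> A = set0 \/ B = set0.

(* Reflections are involutions, so the monoid they generate is the group they *)
(* generate.                                                                  *)
Inductive weyl (D : set V) : 'End(V) -> Prop :=
| weyl1 : weyl D \1%VF
| weylM a w : D a -> weyl D w -> weyl D (refl a \o w)%VF.

End RootSystems.

Section PositiveSystems.
Variables (R : realFieldType) (V : vectType R).

Definition nonneg_comb (Pi : seq V) (v : V) : Prop :=
  exists c : V -> nat, v = \sum_(a <- Pi) a *+ c a.

(* The base is not required to span V, so that the notion also applies to the *)
(* root subsystem in degree 0 of a grading.                                   *)
Definition is_base (D : set V) (Pi : seq V) : Prop :=
  [/\ [set` Pi] `<=` D,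
      free Pi
    & forall a, D a -> nonneg_comb Pi a \/ nonneg_comb Pi (- a)].

Definition pos_roots (D : set V) (Pi : seq V) : set V :=
  [set a | D a /\ nonneg_comb Pi a].

Definition is_positive_system (D P : set V) : Prop :=
  exists2 Pi : seq V, is_base D Pi & P = pos_roots D Pi.

Definition root_le (Pi : seq V) (m g : V) : Prop := nonneg_comb Pi (g - m).

Definition is_zgrading (D : set V) (Dg : int -> set V) : Prop :=
  [/\ \bigcup_i Dg i = D,
      trivIset setT Dg
    & forall i j a b, Dg i a -> Dg j b -> D (a + b) -> Dg (i + j) (a + b)].

Definition deg_ge1 (Dg : int -> set V) : set V :=
  \bigcup_(j in [set j : int | 1 <= j]) Dg j.

Definition deg_le1 (Dg : int -> set V) : set V :=
  \bigcup_(j in [set j : int | j <= 1]) Dg j.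

Definition is_compatible (Dg : int -> set V) (P : set V) : Prop :=
  exists2 P0, is_positive_system (Dg 0) P0 & P = P0 `|` deg_ge1 Dg.

Definition is_lower_ideal (Dg : int -> set V) (Pi : seq V) (I : set V) : Prop :=
  I `<=` Dg 1 /\
  forall g m, I g -> Dg 1 m -> root_le Pi m g -> I m.

(* The exponent is shifted by one: [root_pow D J k] is $J^{k+1}$. *)
Fixpoint root_pow (D J : set V) (k : nat) : set V :=
  if k is k'.+1 then [set a + b | a in J & b in root_pow D J k'] `&` D else J.

Definition generated (D J : set V) : set V := \bigcup_k root_pow D J k.

(* $N(w)$ for the positive system P. *)
Definition inversions (P : set V) (w : 'End(V)) : set V :=
  [set g | P g /\ P (- w g)].

End PositiveSystems.

Section MaximalElements.
Variables (R : realFieldType) (V : vectType R) (f : {dot V for idfun}).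
Variables (D : set V) (Dg : int -> set V) (Pi : seq V).

Definition W0 : set 'End(V) :=
  [set w | weyl f D w /\
     forall a, (Dg 0 `&` pos_roots D Pi) a -> pos_roots D Pi (w a)].

(* "w is $w_{I,max}$", that is, w is the unique element of the Weyl group with *)
(* the prescribed inversion set.                                               *)
Definition is_wmax (I : set V) (w : 'End(V)) : Prop :=
  unique (fun u => weyl f D u /\
    inversions (pos_roots D Pi) u = deg_ge1 Dg `\` generated D (Dg 1 `\` I)) w.

Definition W0max : set 'End(V) :=
  [set w | exists2 I, is_lower_ideal Dg Pi I & is_wmax I w].

End MaximalElements.

(* Main.v *)
(* A root of degree at least two that [w] keeps positive is either the preimage
   of a simple root or the sum of two roots that [w] keeps positive. If [w^-1]
   maps simple roots into degrees at most one, the second case always applies,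
   and summands can be regrouped so that one of the two has degree one; by
   induction such a root is generated by [Dg 1 `\` I], where [I] consists of
   the inversions of [w] of degree one, so [w] inverts exactly the roots
   prescribed for [w_{I,max}]. Conversely, if [w] has that inversion set, a
   simple root whose preimage had degree at least two would be a sum of two
   positive roots. Uniqueness in the definition of [w_{I,max}] comes from the
   exchange condition. *)
Require Import Defs.
From mathcomp Require Import all_boot all_order all_algebra.
From mathcomp Require Import boolp classical_sets.
From mathcomp Require Import zify ring lra.

Set Implicit Arguments.
Unset Strict Implicit.
Unset Printing Implicit Defensive.

Import Order.TTheory GRing.Theory Num.Theory.

Local Open Scope classical_set_scope.
Local Open Scope ring_scope.

(** * Nonnegative combinations and linear forms with prescribed values *)

Lemma nonneg_combD (R : realFieldType) (V : vectType R) (Pi : seq V) u v :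
  nonneg_comb Pi u -> nonneg_comb Pi v -> nonneg_comb Pi (u + v).
Proof.
move=> [c ->] [d ->]; exists (fun a => c a + d a)%N.
by rewrite -big_split; apply: eq_bigr => a _; rewrite mulrnDr.
Qed.

(** Only vectors with a positive coefficient are tested: in the lower ideal argument these are the
    simple roots of degree zero, which elements of [W0] keep positive. *)
Lemma nonneg_comb_sum (R : realFieldType) (V W : vectType R) (w : 'Hom(V, W))
    (Pi : seq V) (Pi' : seq W) (c : V -> nat) :
  (forall a, a \in Pi -> (0 < c a)%N -> nonneg_comb Pi' (w a)) ->
  nonneg_comb Pi' (w (\sum_(a <- Pi) a *+ c a)).
Proof.
move=> wP; rewrite linear_sum big_seq.
elim/big_ind: _ => [||a aPi].
- by exists (fun=> 0%N); rewrite big1.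
- by move=> x y; apply: nonneg_combD.
rewrite raddfMn /=; have [->|c_gt0] := posnP (c a).
  by exists (fun=> 0%N); rewrite big1.
elim: (c a) => [|n IHn].
  by exists (fun=> 0%N); rewrite big1.
by rewrite mulrS; apply: nonneg_combD => //; apply: wP.
Qed.

Lemma nonneg_comb_base (R : realFieldType) (V : vectType R) (Pi : seq V) a :
  uniq Pi -> a \in Pi -> nonneg_comb Pi a.
Proof.
move=> uPi aPi; exists (fun b => nat_of_bool (b == a)).
rewrite (bigD1_seq a) //= eqxx mulr1n big1 ?addr0 // => b /negPf->.
by rewrite mulr0n.
Qed.

(** Source of three linear forms used below: height, a single coordinate, and degree. *)
Lemma linear_ext_of_free (R : realFieldType) (V : vectType R) (Pi : seq V)
    (e : V -> R) : free Pi ->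
  exists L : {linear V -> R^o}, forall a, a \in Pi -> L a = e a.
Proof.
move=> freePi; have [L LP] := linear_of_free Pi (map e Pi : seq R^o).
exists L => a aPi; have := LP freePi (size_map _ _).
by move/eq_in_map; apply.
Qed.

(** * Inner product, reflections and sums of roots *)

Section RootSystem.
Variables (R : realFieldType) (V : vectType R) (f : {dot V for idfun}).
Variables (D : set V) (Pi : seq V).
Hypotheses (D_root_system : is_root_system f D) (D_reduced : is_reduced D).
Hypothesis (Pi_base : is_base D Pi).
Implicit Types (a b c u v : V).

Local Notation P := (pos_roots D Pi).

Lemma dotC u v : f u v = f v u.
Proof. by rewrite (hermC f u v) /= mul1r. Qed.

Lemma dotZ k u v : (f (k *: u) v = k * f u v) * (f u (k *: v) = k * f u v).
Proof. by split; [exact: linearZl_LR | exact: linearZr_LR]. Qed.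

Lemma dotN u v : (f (- u) v = - f u v) * (f u (- v) = - f u v).
Proof. by split; [exact: linearNl | exact: linearNr]. Qed.

Lemma dotD u v c :
  (f (u + v) c = f u c + f v c) * (f c (u + v) = f c u + f c v).
Proof. by split; [exact: linearDl | exact: linearDr]. Qed.

Lemma dotB u v c :
  (f (u - v) c = f u c - f v c) * (f c (u - v) = f c u - f c v).
Proof. by rewrite !dotD !dotN. Qed.

Lemma dot_gt0 a : a != 0 -> 0 < f a a.
Proof. exact: neq0_dnorm_gt0. Qed.

Lemma root_neq0 a : D a -> a != 0.
Proof.
by move=> Da; apply/eqP => a0; case: D_root_system => _ + _ _ _; rewrite -a0.
Qed.

Lemma root_dot_gt0 a : D a -> 0 < f a a.
Proof. by move/root_neq0; exact: dot_gt0. Qed.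

Lemma refl_root a b : D a -> D b -> D (refl f a b).
Proof. by case: D_root_system => _ _ _ + _; apply. Qed.

Lemma refl_self a : a != 0 -> refl f a a = - a.
Proof.
move=> /dot_gt0 /lt0r_neq0 faa; rewrite reflE mulfK //.
by rewrite scaler_nat mulr2n opprD addrA subrr add0r.
Qed.

Lemma rootN a : D a -> D (- a).
Proof.
by move=> Da; rewrite -refl_self ?root_neq0 //; apply: refl_root.
Qed.

Lemma reflN a : refl f (- a) = refl f a.
Proof.
apply/lfunP => v; rewrite !reflE !dotN.
by rewrite scalerN opprK mulrN mulNr scaleNr opprK.
Qed.

Lemma refl_isometry a u v : a != 0 -> f (refl f a u) (refl f a v) = f u v.
Proof.
move=> /dot_gt0 /lt0r_neq0 faa; rewrite !reflE.
rewrite !(dotB, dotZ) (dotC a v).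
by field.
Qed.

Lemma reflK a : a != 0 -> involutive (refl f a).
Proof.
move=> a0 v; rewrite !reflE dotB dotZ.
have /lt0r_neq0 faa := dot_gt0 a0.
rewrite -addrA -opprD -scalerDl [X in X *: a](_ : _ = 0); last by field.
by rewrite scale0r subr0.
Qed.

(** If one of the two Cartan integers is 1, a reflection produces the difference up to sign. If both
    are at least 2, then [f (a - b) (a - b) <= 0], which forces [a = b]. *)
Lemma root_sub a b : D a -> D b -> a != b -> 0 < f a b -> D (a - b).
Proof.
move=> Da Db neq_ab ab_gt0.
have [_ _ _ _ intD] := D_root_system.
have cases x y : D x -> D y -> 0 < f y x ->
    D (y - x) \/ 2 * f x x <= 2 * f y x.
  move=> Dx Dy yx_gt0; have [m mE] := intD _ _ Dx Dy.
  have xx_gt0 := root_dot_gt0 Dx.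
  have : 0 < m%:~R :> R by rewrite -mE divr_gt0 // mulr_gt0.
  rewrite ltr0z => m_gt0; have [m1|m_neq1] := eqVneq m 1.
    by left; have := refl_root Dx Dy; rewrite reflE mE m1 scale1r.
  right; have : 2 <= m%:~R :> R by rewrite (ler_int R 2); lia.
  by rewrite -mE ler_pdivlMr.
case: (cases b a Db Da ab_gt0) => // ge_bb.
have ba_gt0 : 0 < f b a by rewrite dotC.
case: (cases a b Da Db ba_gt0) => [/rootN|ge_aa].
  by rewrite opprB.
have : 0 < f (a - b) (a - b) by rewrite dot_gt0 // subr_eq0.
by rewrite !dotB; move: (dotC b a) => ?; lra.
Qed.

Lemma root_add a b : D a -> D b -> a + b != 0 -> f a b < 0 -> D (a + b).
Proof.
move=> Da /rootN Db ab0 ab_lt0; rewrite -[b]opprK; apply: root_sub => //.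
  by rewrite -subr_eq0 opprK.
by rewrite dotN oppr_gt0.
Qed.

(** Otherwise [f a b] and [f a c] are nonnegative. With [s = a + b + c], neither [s - b] nor [s - c]
    is a root, so [f s b] and [f s c] are nonpositive; yet their sum is [f a b + f a c] plus the
    positive number [f (b + c) (b + c)]. *)
Lemma root_triple a b c : D a -> D b -> D c -> D (b + c) -> D (a + b + c) ->
  a + b != 0 -> a + c != 0 -> D (a + b) \/ D (a + c).
Proof.
move=> Da Db Dc Dbc Dabc ab0 ac0; apply: contrapT => /not_orP[nab nac].
have ab_ge0 : 0 <= f a b by rewrite leNgt; apply/negP => /(root_add Da Db ab0).
have ac_ge0 : 0 <= f a c by rewrite leNgt; apply/negP => /(root_add Da Dc ac0).
have sb_le0 : f (a + b + c) b <= 0.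
  rewrite leNgt; apply/negP => /(root_sub Dabc Db).
  by rewrite -subr_eq0 addrAC addrK => /(_ ac0).
have sc_le0 : f (a + b + c) c <= 0.
  rewrite leNgt; apply/negP => /(root_sub Dabc Dc).
  by rewrite -subr_eq0 addrK => /(_ ab0).
have := root_dot_gt0 Dbc; move: sb_le0 sc_le0.
by rewrite !dotD; lra.
Qed.


(** * Bases, heights and positive roots *)

Lemma base_free : free Pi. Proof. by case: Pi_base. Qed.

Lemma base_uniq : uniq Pi. Proof. exact: free_uniq base_free. Qed.

Lemma linear_comb (L : {linear V -> R^o}) (e : V -> R) (c : V -> nat) :
  (forall a, a \in Pi -> L a = e a) ->
  L (\sum_(a <- Pi) a *+ c a) = \sum_(a <- Pi) e a *+ c a.
Proof.
move=> LE; rewrite linear_sum big_seq [RHS]big_seq.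
by apply: eq_bigr => a aPi; rewrite raddfMn /= LE.
Qed.

(** A linear form on all of [V], so that heights of sums, differences and reflected roots follow by
    linearity. *)
Definition height : {linear V -> R^o} :=
  sval (cid (linear_ext_of_free (fun=> 1) base_free)).

Lemma height_simple a : a \in Pi -> height a = 1.
Proof. by rewrite /height; case: cid => /= L; apply. Qed.

Lemma height_comb (c : V -> nat) :
  height (\sum_(a <- Pi) a *+ c a) = (\sum_(a <- Pi) c a)%:R.
Proof.
by rewrite (linear_comb _ height_simple) natr_sum; apply: eq_bigr.
Qed.

Lemma height_ge0 v : nonneg_comb Pi v -> 0 <= height v.
Proof. by move=> [c ->]; rewrite height_comb ler0n. Qed.

Lemma height_eq0 v : nonneg_comb Pi v -> height v = 0 -> v = 0.
Proof.
move=> [c ->]; rewrite height_comb => /eqP.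
rewrite pnatr_eq0 sum_nat_seq_eq0 => /allP c0.
by rewrite big_seq big1 // => a /c0 /= /eqP->.
Qed.

Lemma nonneg_comb_anti v : nonneg_comb Pi v -> nonneg_comb Pi (- v) -> v = 0.
Proof.
move=> v_ge0 /height_ge0; rewrite linearN oppr_ge0 => hv_le0.
by apply: height_eq0 => //; apply: le_anti; rewrite hv_le0 height_ge0.
Qed.

Lemma pos_root_or_opp a : D a -> P a \/ P (- a).
Proof.
move=> Da; case: Pi_base => _ _ /(_ a Da)[]; [left|right]; split=> //.
exact: rootN.
Qed.

Lemma pos_root_not_opp a : P a -> ~ P (- a).
Proof.
move=> [Da a_ge0] [_ Na_ge0].
by have := root_neq0 Da; rewrite (nonneg_comb_anti a_ge0 Na_ge0) eqxx.
Qed.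

Lemma simple_root a : a \in Pi -> D a.
Proof. by case: Pi_base => + _ _; apply. Qed.

Lemma simple_pos_root a : a \in Pi -> P a.
Proof.
move=> aPi; split; first exact: simple_root.
exact: nonneg_comb_base base_uniq aPi.
Qed.

Lemma height_ge1 a : P a -> 1 <= height a.
Proof.
move=> [/root_neq0 a0 a_ge0]; have [c ac] := a_ge0.
rewrite ac height_comb (ler_nat _ 1) lt0n; apply: contra a0 => /eqP s0.
by apply/eqP/height_eq0 => //; rewrite ac height_comb s0.
Qed.

Lemma simple_indecomposable a b : P a -> P b -> a + b \notin Pi.
Proof.
move=> /height_ge1 ha /height_ge1 hb; apply/negP => /height_simple.
by rewrite linearD /=; lra.
Qed.

(** Heights lie in [R], where strict descent need not be well founded; on positive roots they are
    natural numbers, which carry the induction. *)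
Lemma height_ind (K : V -> Prop) :
  (forall b, P b -> (forall c, P c -> height c < height b -> K c) -> K b) ->
  forall b, P b -> K b.
Proof.
move=> step b Pb; have [_ [c bc]] := Pb.
have [n] : exists n : nat, height b = n%:R.
  by exists (\sum_(a <- Pi) c a)%N; rewrite bc height_comb.
elim/ltn_ind: n b Pb {c bc} => n IHn b Pb hb; apply: step => // c Pc.
have [_ [k ck]] := Pc; rewrite hb {1}ck height_comb ltr_nat => lt_cn.
by apply: (IHn _ lt_cn) => //; rewrite {1}ck height_comb.
Qed.

(** Otherwise, expanding one copy of [b] in simple roots would give [f b b <= 0]. *)
Lemma exists_simple_dot_gt0 b : P b -> exists2 a, a \in Pi & 0 < f b a.
Proof.
move=> [Db [c bc]]; apply: contrapT => no_a.
have := root_dot_gt0 Db; rewrite {2}bc linear_sumr big_seq.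
apply/negP; rewrite -leNgt; apply: sumr_le0 => a aPi.
rewrite linearMnr mulrn_wle0 // leNgt; apply/negP => ba_gt0.
by apply: no_a; exists a.
Qed.

Lemma pos_root_sub_simple b :
  P b -> b \notin Pi -> exists2 a, a \in Pi & P (b - a).
Proof.
move=> Pb bPi; have [a aPi ba_gt0] := exists_simple_dot_gt0 Pb.
have neq_ba : b != a by apply: contraNneq bPi => ->.
exists a => //; have [Db _] := Pb.
case: (pos_root_or_opp (root_sub Db (simple_root aPi) neq_ba ba_gt0)) => //.
move=> /height_ge1; rewrite linearN linearB /= (height_simple aPi).
by have := height_ge1 Pb; lra.
Qed.

(** The reflection changes only the coefficient at [a]. If the image were negative, all other
    coefficients would vanish, so [b] would be a multiple of [a], and reducedness would give
    [b = a]. *)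
Lemma refl_simple_pos a b : a \in Pi -> P b -> b != a -> P (refl f a b).
Proof.
move=> aPi Pb; have [Db [k bk]] := Pb.
case: (pos_root_or_opp (refl_root (simple_root aPi) Db)) => // -[_ [l Eb]].
have coord_eq0 c : c \in Pi -> c != a -> k c = 0%N.
  move=> cPi neq_ca.
  (* [L] reads the coordinate at [c], which the reflection fixes: it equals both [k c] and [- l c],
     so it is zero. *)
  have [L LE] := linear_ext_of_free (fun x => (x == c)%:R) base_free.
  have LcombE m : L (\sum_(x <- Pi) x *+ m x) = (m c)%:R.
    rewrite (linear_comb _ LE) (bigD1_seq c) //= ?base_uniq // eqxx.
    by rewrite big1 ?addr0 // => x /negPf->; rewrite mul0rn.
  have /(congr1 L) := Eb; rewrite reflE linearN linearB linearZ /=.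
  rewrite LcombE (LE a aPi) (eq_sym a) (negPf neq_ca) scaler0 subr0.
  rewrite {1}bk LcombE => kl; apply/eqP; rewrite -(pnatr_eq0 R).
  by apply/eqP; move: (ler0n R (k c)) (ler0n R (l c)); lra.
have bE : b = (k a)%:R *: a.
  rewrite scaler_nat {1}bk (bigD1_seq a) //= ?base_uniq //.
  rewrite big_seq_cond big1 ?addr0 // => c /andP[cPi neq_ca].
  by rewrite coord_eq0.
move: Db; rewrite bE => /(D_reduced (simple_root aPi))[->|k_lt0].
  by rewrite scale1r eqxx.
by have := ler0n R (k a); rewrite k_lt0; lra.
Qed.

(** * The Weyl group as a group of isometries preserving the roots *)

Lemma weyl_root w a : weyl f D w -> D a -> D (w a).
Proof.
move=> Ww Da; elim: Ww => [|b {}w Db _ Dwa]; first by rewrite id_lfunE.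
by rewrite comp_lfunE; apply: refl_root.
Qed.

Lemma weyl_isometry w u v : weyl f D w -> f (w u) (w v) = f u v.
Proof.
move=> Ww; elim: Ww => [|b {}w Db _ IHw]; first by rewrite !id_lfunE.
by rewrite !comp_lfunE /= refl_isometry ?root_neq0.
Qed.

Lemma weyl_refl w a : weyl f D w -> (refl f (w a) \o w = w \o refl f a)%VF.
Proof.
move=> Ww; apply/lfunP => v; rewrite !comp_lfunE !reflE !weyl_isometry //.
by rewrite [w (_ - _)]linearB /= [w (_ *: a)]linearZ.
Qed.

Lemma weyl_comp w w' : weyl f D w -> weyl f D w' -> weyl f D (w \o w')%VF.
Proof.
move=> Ww Ww'; elim: Ww => [|b {}w Db _ IHw]; first by rewrite comp_lfun1l.
by rewrite -comp_lfunA; apply: weylM.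
Qed.

Lemma refl_sqr a : D a -> (refl f a \o refl f a = \1)%VF.
Proof.
move=> /root_neq0 a0; apply/lfunP => v.
by rewrite comp_lfunE /= reflK // id_lfunE.
Qed.

Lemma weyl_refl1 a : D a -> weyl f D (refl f a).
Proof.
by move=> Da; rewrite -[refl f a]comp_lfun1r; apply: weylM => //; left.
Qed.

Lemma weyl_inv w : weyl f D w ->
  exists w', [/\ weyl f D w', (w' \o w = \1)%VF & (w \o w' = \1)%VF].
Proof.
move=> Ww; elim: Ww => [|b {}w Db _ [w' [Ww' w'w ww']]].
  by exists \1%VF; rewrite comp_lfun1l; split=> //; left.
exists (w' \o refl f b)%VF; split.
- exact: weyl_comp (weyl_refl1 Db).
- by rewrite comp_lfunA -(comp_lfunA w') refl_sqr // comp_lfun1r.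
- by rewrite comp_lfunA -(comp_lfunA _ w) ww' comp_lfun1r refl_sqr.
Qed.

(** * Words in simple reflections and the exchange condition *)

Definition refl_word (s : seq V) : 'End(V) :=
  foldr (fun a w => refl f a \o w)%VF \1%VF s.

Lemma refl_word_cat s t :
  refl_word (s ++ t) = (refl_word s \o refl_word t)%VF.
Proof.
elim: s => [|a s IHs] /=; first by rewrite comp_lfun1l.
by rewrite IHs comp_lfunA.
Qed.

Lemma weyl_refl_word s : {subset s <= Pi} -> weyl f D (refl_word s).
Proof.
elim: s => [_|a s IHs sPi] /=; first by left.
right; first by apply/simple_root/sPi/mem_head.
by apply: IHs => b bs; apply: sPi; rewrite inE bs orbT.
Qed.

(** Induction on height: a simple [a] with [0 < f b a] makes [refl f a b] a lower positive root, and
    conjugating its reflection by [refl f a] gives back [refl f b]. *)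
Lemma refl_pos_root_word b : P b ->
  exists2 s, {subset s <= Pi} & refl f b = refl_word s.
Proof.
move: b; apply: height_ind => b Pb IHb; have [bPi|bPi] := boolP (b \in Pi).
  exists [:: b]; first by move=> a; rewrite inE => /eqP->.
  by rewrite /= comp_lfun1r.
have [a aPi ba_gt0] := exists_simple_dot_gt0 Pb.
have Da := simple_root aPi; have neq_ba : b != a by apply: contraNneq bPi => ->.
have [||s sPi Es] := IHb (refl f a b); first exact: refl_simple_pos.
  rewrite reflE linearB linearZ /= (height_simple aPi) /GRing.scale /=.
  rewrite mulr1 gtrBl.
  by rewrite divr_gt0 ?mulr_gt0 // root_dot_gt0.
exists (a :: s ++ [:: a]).
  by move=> c; rewrite !inE mem_cat inE => /or3P[/eqP->|/sPi|/eqP->].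
rewrite /= refl_word_cat -Es /= comp_lfun1r (weyl_refl _ (weyl_refl1 Da)).
by rewrite comp_lfunA refl_sqr // comp_lfun1l.
Qed.

Lemma weyl_refl_wordP w : weyl f D w ->
  exists2 s, {subset s <= Pi} & w = refl_word s.
Proof.
move=> Ww; elim: Ww => [|b {}w Db _ [s sPi ->]]; first by exists [::].
have [t tPi ->] : exists2 t, {subset t <= Pi} & refl f b = refl_word t.
  by case: (pos_root_or_opp Db) => /refl_pos_root_word; rewrite ?reflN.
exists (t ++ s); last by rewrite refl_word_cat.
by move=> a; rewrite mem_cat => /orP[/tPi|/sPi].
Qed.

(** Letters act from right to left on the positive root [a]. A letter that makes it negative must
    equal the root it meets, because a simple reflection keeps every other positive root
    positive. *)
Lemma refl_word_exchange s a : {subset s <= Pi} -> a \in Pi ->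
    P (- refl_word s a) ->
  exists t1 b t2, s = t1 ++ b :: t2 /\ refl_word t2 a = b.
Proof.
move=> + aPi; elim: s => [_|c s IHs csPi] /=.
  by rewrite id_lfunE => /(pos_root_not_opp (simple_pos_root aPi)).
have sPi : {subset s <= Pi} by move=> b bs; apply: csPi; rewrite inE bs orbT.
have cPi : c \in Pi by apply/csPi/mem_head.
rewrite comp_lfunE /= => neg.
have Dsa : D (refl_word s a) :=
  weyl_root (weyl_refl_word sPi) (simple_root aPi).
case: (pos_root_or_opp Dsa) => [pos|]; last first.
  by move=> /(IHs sPi)[t1 [b [t2 [-> ?]]]]; exists (c :: t1), b, t2.
exists [::], c, s; split=> //; apply/eqP; apply: contraPT neg => neq_c.
by apply: pos_root_not_opp; apply: refl_simple_pos.
Qed.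

(** Induction on length: the word preceding the last letter [a] sends [a] to a negative root, so the
    exchange condition removes [a] together with an earlier letter. *)
Lemma refl_word_pos_eq1 s : {subset s <= Pi} ->
  (forall a, a \in Pi -> P (refl_word s a)) -> refl_word s = \1%VF.
Proof.
have [n] := ubnP (size s); elim: n s => // n IHn s.
case/lastP: s => [//|s a]; rewrite size_rcons ltnS => lt_sn saPi pos.
have aPi : a \in Pi by apply: saPi; rewrite mem_rcons mem_head.
have sPi : {subset s <= Pi}.
  by move=> b bs; apply: saPi; rewrite mem_rcons inE bs orbT.
have [|t1 [b [t2 [sE bE]]]] := refl_word_exchange sPi aPi.
  have := pos a aPi; rewrite -cats1 refl_word_cat /= comp_lfun1r comp_lfunE /=.
  by rewrite refl_self ?linearN //; apply/root_neq0/simple_root.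
have t2Pi : {subset t2 <= Pi}.
  by move=> c ct; apply: sPi; rewrite sE mem_cat inE ct !orbT.
have E : refl_word (rcons s a) = refl_word (t1 ++ t2).
  (* Moving [refl f b] past [t2] turns it into [refl f a], which cancels the last letter. *)
  rewrite -cats1 sE !refl_word_cat /= comp_lfun1r -bE.
  rewrite (weyl_refl _ (weyl_refl_word t2Pi)) -!comp_lfunA refl_sqr.
    by rewrite comp_lfun1r.
  exact: simple_root.
rewrite E; apply: IHn; last by rewrite -E.
  by apply: leq_trans lt_sn; rewrite sE !size_cat /= addnS.
move=> c; rewrite mem_cat => /orP[ct|/t2Pi //].
by apply: sPi; rewrite sE mem_cat ct.
Qed.

Lemma weyl_pos_eq1 w : weyl f D w -> (forall a, P a -> P (w a)) -> w = \1%VF.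
Proof.
move=> /weyl_refl_wordP[s sPi ->] pos; apply: refl_word_pos_eq1 => // a aPi.
exact/pos/simple_pos_root.
Qed.

(** It suffices that [u] composed with the inverse of [w] keeps each positive [a] positive. If the
    preimage of [a] under [w] is positive, [w] does not invert it, so neither does [u]; if it is
    negative, both invert its opposite. *)
Lemma weyl_inversions_inj (u w : 'End(V)) : weyl f D u -> weyl f D w ->
  inversions P u = inversions P w -> u = w.
Proof.
move=> Wu Ww eqN; have [w' [Ww' w'w ww']] := weyl_inv Ww.
suff uw' : (u \o w' = \1)%VF.
  by rewrite -[u]comp_lfun1r -w'w comp_lfunA uw' comp_lfun1l.
apply: weyl_pos_eq1 (weyl_comp Wu Ww') _ => a Pa; have [Da _] := Pa.
have wK : w (w' a) = a by rewrite -comp_lfunE ww' id_lfunE.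
have Dw'a := weyl_root Ww' Da; rewrite comp_lfunE.
case: (pos_root_or_opp Dw'a) => [pos|neg].
  case: (pos_root_or_opp (weyl_root Wu Dw'a)) => // neg.
  have : inversions P w (w' a) by rewrite -eqN.
  by case=> _; rewrite wK => /(pos_root_not_opp Pa).
have : inversions P u (- w' a).
  by rewrite eqN; split=> //; rewrite [w (- _)]linearN /= opprK wK.
by case=> _; rewrite [u (- _)]linearN opprK.
Qed.

Lemma pos_rootD_neq0 a b : P a -> P b -> a + b != 0.
Proof.
move=> /height_ge1 ha /height_ge1 hb; apply/eqP => /(congr1 height).
by rewrite linearD linear0 /=; lra.
Qed.

Lemma pos_rootD a b : P a -> P b -> D (a + b) -> P (a + b).
Proof. by move=> [_ a_ge0] [_ b_ge0] Dab; split=> //; apply: nonneg_combD. Qed.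

(** * Arbitrary gradings and splitting off a root of degree one *)

Section Grading.
Variable Dg : int -> set V.
Hypothesis D_grading : is_zgrading D Dg.

Lemma deg_root i a : Dg i a -> D a.
Proof. by case: D_grading => <- _ _ Dia; exists i. Qed.

Lemma root_deg a : D a -> exists i, Dg i a.
Proof.
by case: D_grading => DE _ _; rewrite -{1}DE => -[i _ Dia]; exists i.
Qed.

Lemma deg_inj i j a : Dg i a -> Dg j a -> i = j.
Proof.
case: D_grading => _ disj _ Dia Dja; apply: (disj i j) => //.
by exists a.
Qed.

Lemma deg_add i j a b : Dg i a -> Dg j b -> D (a + b) -> Dg (i + j) (a + b).
Proof. by case: D_grading => _ _; apply. Qed.

(* Split off a simple root and move summands of degree one from the remainder
   into it, using [root_triple], until the remainder has degree [k - 1]. *)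
Lemma pos_root_split_deg1 x (k : int) :
  (forall a, a \in Pi -> deg_le1 Dg a) -> P x -> 2 <= k -> Dg k x ->
  exists y z, [/\ x = y + z, P y, P z, Dg 1 y & Dg (k - 1) z].
Proof.
move=> simple_le1 Px; move: x Px k; apply: height_ind => x Px IHx k k_ge2 Dkx.
suff split_rec b : P b -> forall a (e : int), P a -> Dg e a -> e <= 1 ->
    x = a + b ->
    exists y z, [/\ x = y + z, P y, P z, Dg 1 y & Dg (k - 1) z].
  have xPi : x \notin Pi.
    apply/negP => /simple_le1[j /= j_le1 Djx].
    by have := deg_inj Dkx Djx; lia.
  have [a aPi Pb] := pos_root_sub_simple Px xPi.
  have [e /= e_le1 Dea] := simple_le1 a aPi.
  apply: (split_rec (x - a) Pb a e) => //; first exact: simple_pos_root.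
  by rewrite addrC subrK.
move=> Pb; move: b Pb; apply: height_ind => b Pb IHb a e Pa Dea e_le1 xE.
have [j Djb] := root_deg (proj1 Pb).
have Dx := proj1 Px.
have kE : k = e + j.
  by apply: deg_inj Dkx _; rewrite xE; apply: deg_add; rewrite -?xE.
have [e1|e_neq1] := eqVneq e 1.
  by exists a, b; split=> //; [rewrite -e1 | rewrite kE e1 addrC addKr].
have lt_bx : height b < height x.
  by rewrite xE linearD /=; have := height_ge1 Pa; lra.
(* Here [e <= 0], so [b] has degree at least two and, being lower than [x], splits as [b1 + b'] by
   the outer induction. Either [a] absorbs [b1], keeping degree at most one and lowering the
   remainder, or [a + b'] is a root of degree [k - 1]. *)
have j_ge2 : 2 <= j by lia.
have [b1 [b' [bE Pb1 Pb' Db1 Db']]] := IHx b Pb lt_bx j j_ge2 Djb.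
have [||Dab|Dab'] := root_triple (proj1 Pa) (proj1 Pb1) (proj1 Pb') _ _
  (pos_rootD_neq0 Pa Pb1) (pos_rootD_neq0 Pa Pb').
- by rewrite -bE; case: Pb.
- by rewrite -addrA -bE -xE.
- apply: (IHb b' Pb' _ (a + b1) (e + 1)).
  + by rewrite bE linearD /=; have := height_ge1 Pb1; lra.
  + exact: pos_rootD.
  + exact: deg_add.
  + lia.
  + by rewrite xE bE addrA.
exists b1, (a + b'); split=> //.
- by rewrite xE bE addrCA.
- exact: pos_rootD.
- have -> : k - 1 = e + (j - 1) by lia.
  exact: deg_add.
Qed.

End Grading.

(** Transporting degrees turns a condition on preimages of simple roots under [w] into one on the
    simple roots themselves. Positive roots may then have negative degree, which is why
    [pos_root_split_deg1] is stated without compatibility. *)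
Lemma pullback_zgrading (Dg : int -> set V) w w' :
  is_zgrading D Dg -> weyl f D w -> weyl f D w' -> (w \o w' = \1)%VF ->
  is_zgrading D (fun i => w' @^-1` Dg i).
Proof.
move=> Dg_grading Ww Ww' ww'.
have wK a : w (w' a) = a by rewrite -comp_lfunE ww' id_lfunE.
split.
- apply/seteqP; split=> [a [i _ /= Dia]|a Da].
    by rewrite -[a]wK; apply: weyl_root Ww (deg_root Dg_grading Dia).
  have [i Di] := root_deg Dg_grading (weyl_root Ww' Da).
  by exists i.
- by move=> i j _ _ [a [/= Di Dj]]; apply: deg_inj Di Dj.
- move=> i j a b /= Dia Djb Dab; rewrite linearD.
  apply: deg_add Dia Djb _ => //=.
  by rewrite -linearD; apply: weyl_root.
Qed.

(** * Compatible gradings, inversion sets and generated sets *)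

Section CompatibleGrading.
Variable Dg : int -> set V.
Hypotheses (D_grading : is_zgrading D Dg).
Hypotheses (Dpos_compatible : is_compatible Dg P).

Lemma deg_ge1_pos_root a : deg_ge1 Dg a -> P a.
Proof. by case: Dpos_compatible => P0 _ -> ?; right. Qed.

Lemma pos_root_deg a : P a -> Dg 0 a \/ deg_ge1 Dg a.
Proof.
case: Dpos_compatible => P0 [Pi0 _ ->] -> [[D0a _]|]; first by left.
by right.
Qed.

Lemma pos_root_deg_ge0 i a : P a -> Dg i a -> 0 <= i.
Proof.
move=> /pos_root_deg[D0a|[j /= j_ge1 Dja]] Dia.
  by rewrite (deg_inj D_grading Dia D0a).
by rewrite (deg_inj D_grading Dia Dja); lia.
Qed.

Lemma deg0_not_deg_ge1 a : Dg 0 a -> ~ deg_ge1 Dg a.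
Proof.
by move=> D0a [j /= j_ge1 Dja]; have := deg_inj D_grading D0a Dja; lia.
Qed.

(** The form is fixed by the degrees of the simple roots and reaches every positive root by removing
    one simple root at a time. Compatibility makes its values on simple roots nonnegative. *)
Lemma exists_linear_deg : exists2 L : {linear V -> R^o},
  forall a i, P a -> Dg i a -> L a = i%:~R & forall a, a \in Pi -> 0 <= L a.
Proof.
have [d dP] : {d : V -> int & forall a, D a -> Dg (d a) a}.
  have ex a : exists i, D a -> Dg i a.
    have [/(root_deg D_grading)[i Dia]|nDa] := pselect (D a); first by exists i.
    by exists 0.
  by exists (fun a => sval (cid (ex a))) => a; case: cid.
have [L LE] := linear_ext_of_free (fun a => (d a)%:~R) base_free.
exists L => [a i Pa|a aPi]; last first.
  have Pa := simple_pos_root aPi.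
  by rewrite LE // ler0z (pos_root_deg_ge0 Pa) //; apply: dP; case: Pa.
move: a Pa i; apply: height_ind => b Pb IHb i Dib.
have [bPi|bPi] := boolP (b \in Pi).
  by rewrite LE // (deg_inj D_grading (dP b (proj1 Pb)) Dib).
have [a aPi Pba] := pos_root_sub_simple Pb bPi.
have Pa := simple_pos_root aPi.
have [j Djba] := root_deg D_grading (proj1 Pba).
have Da := dP a (proj1 Pa).
have bE : b = a + (b - a) by rewrite addrC subrK.
have -> : i = d a + j.
  apply: (deg_inj D_grading Dib); rewrite bE; apply: (deg_add D_grading) => //.
  by rewrite -bE; case: Pb.
rewrite bE linearD /= LE // (IHb _ Pba _ j) //; first by rewrite intrD.
by rewrite linearB /= (height_simple aPi); lra.
Qed.

Lemma W0P w : W0 f D Dg Pi w <->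
  weyl f D w /\ inversions P w `<=` deg_ge1 Dg.
Proof.
split=> -[Ww w0]; split=> // a.
  move=> [Pa Nwa]; have [D0a|//] := pos_root_deg Pa.
  by case: (pos_root_not_opp (w0 a _)).
move=> [D0a Pa]; case: (pos_root_or_opp (weyl_root Ww (proj1 Pa))) => // Nwa.
by case: (deg0_not_deg_ge1 D0a); apply: w0.
Qed.

(** If [m] lies below [g] in degree one, then [g - m] involves only simple roots of degree zero, so
    [w (g - m)] is a nonnegative combination. Were [w m] positive, [w g] would be positive too. *)
Lemma inversions_lower_ideal w : W0 f D Dg Pi w ->
  is_lower_ideal Dg Pi (inversions P w `&` Dg 1).
Proof.
move=> [Ww w0]; split=> [a [_ //]|g m [[Pg Nwg] D1g] D1m [c gmE]].
have Pm : P m by apply: deg_ge1_pos_root; exists 1.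
split=> //; split=> //.
case: (pos_root_or_opp (weyl_root Ww (proj1 Pm))) => // pos_wm.
have [L LE L_ge0] := exists_linear_deg.
have Lgm : \sum_(a <- Pi) L a *+ c a = 0.
  rewrite -(linear_comb _ (fun _ _ => erefl)) -gmE linearB /=.
  by rewrite !(LE _ 1) // subrr.
(* The sum in [Lgm] has nonnegative terms, so each of them vanishes. *)
have L0 a : a \in Pi -> (0 < c a)%N -> L a = 0.
  move=> aPi c_gt0; move/eqP: Lgm.
  rewrite (bigD1_seq a) //= ?base_uniq // paddr_eq0.
  - by rewrite mulrn_eq0 eqn0Ngt c_gt0 /= => /andP[/eqP].
  - by rewrite mulrn_wge0 ?L_ge0.
  rewrite big_seq_cond sumr_ge0 // => b /andP[bPi _].
  by rewrite mulrn_wge0 ?L_ge0.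
have : nonneg_comb Pi (w (g - m)).
  rewrite gmE; apply: nonneg_comb_sum => a aPi c_gt0.
  have Pa := simple_pos_root aPi.
  have [i Dia] := root_deg D_grading (proj1 Pa).
  have i0 : i = 0.
    by apply/eqP; rewrite -(intr_eq0 R) -(LE a i) // L0.
  by rewrite i0 in Dia; case: (w0 a).
move=> wgm_ge0; case: (@pos_root_not_opp (w g)) => //; split.
  by apply: weyl_root; case: Pg.
rewrite -[g](subrK m) linearD; apply: nonneg_combD => //.
by case: pos_wm.
Qed.

Lemma root_pow_deg (J : set V) k a : J `<=` Dg 1 ->
  root_pow D J k a -> Dg k.+1%:Z a.
Proof.
move=> J1; elim: k a => [|k IHk] a /=; first exact: J1.
move=> [[b Jb [c Jc <-]] Dbc]; rewrite -add1n PoszD.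
by apply: (deg_add D_grading) => //; [apply: J1 | apply: IHk].
Qed.

Lemma generated_nonneg (J : set V) (w : 'End(V)) a :
  (forall b, J b -> nonneg_comb Pi (w b)) -> generated D J a ->
  nonneg_comb Pi (w a).
Proof.
move=> J_ge0 [k _]; elim: k a => [|k IHk] a /=; first exact: J_ge0.
move=> [[b Jb [c Jc <-]] _]; rewrite linearD.
by apply: nonneg_combD; [apply: J_ge0 | apply: IHk].
Qed.

(** The induction is on the height of [x], not of [w' x]. In degree at least two, the pulled back
    grading splits [x] as [y + z]: the root [w' y] has degree one and is not inverted, since [w]
    sends it to the positive root [y], while [z] is lower than [x]. *)
Lemma pos_image_generated w w' (k : int) x :
  weyl f D w -> weyl f D w' -> (w \o w' = \1)%VF ->
  (forall a, a \in Pi -> deg_le1 Dg (w' a)) ->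
  P x -> 1 <= k -> Dg k (w' x) ->
  generated D (Dg 1 `\` (inversions P w `&` Dg 1)) (w' x).
Proof.
move=> Ww Ww' ww' le1 Px; move: x Px k; apply: height_ind.
move=> x Px IHx k k_ge1 Dkx.
have inJ y : P y -> Dg 1 (w' y) ->
    (Dg 1 `\` (inversions P w `&` Dg 1)) (w' y).
  move=> Py D1y; split=> // -[[_ Ny] _].
  by move: Ny; rewrite -comp_lfunE ww' id_lfunE; apply: pos_root_not_opp.
have [k1|k_neq1] := eqVneq k 1.
  by exists 0%N => //=; apply: inJ => //; rewrite -k1.
have k_ge2 : 2 <= k by lia.
have [y [z [xE Py Pz D1y Dz]]] :=
  pos_root_split_deg1 (pullback_zgrading D_grading Ww Ww' ww') le1 Px k_ge2 Dkx.
have lt_zx : height z < height x.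
  by rewrite xE linearD /=; have := height_ge1 Py; lra.
have [|m _ zm] := IHx z Pz lt_zx (k - 1) _ Dz; first by lia.
exists m.+1 => //=; split; last by apply: weyl_root Ww' (proj1 Px).
by exists (w' y); [apply: inJ | exists (w' z) => //; rewrite xE linearD].
Qed.

End CompatibleGrading.

End RootSystem.

(** * Both inclusions, by comparison of inversion sets *)

Theorem theorem3p9 (R : realFieldType) (V : vectType R) (f : {dot V for idfun})
    (D : set V) (Dg : int -> set V) (Pi : seq V)
    (D_root_system : is_root_system f D)
    (D_reduced : is_reduced D)
    (D_irreducible : is_irreducible f D)
    (D_grading : is_zgrading D Dg)
    (Pi_base : is_base D Pi)
    (Dpos_compatible : is_compatible Dg (pos_roots D Pi)) :
  W0max f D Dg Pi =
  [set w : 'End(V) | W0 f D Dg Pi w /\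
     forall a, a \in Pi -> deg_le1 Dg ((w^-1)%VF a)].
Proof.
(* The inverse [w^-1] is defined for every endomorphism; a two-sided inverse makes the kernel
   trivial, and then the two agree. *)
have invE (w w' : 'End(V)) :
    (w' \o w = \1)%VF -> (w \o w' = \1)%VF -> (w^-1)%VF = w'.
  move=> w'w ww'; have w_inj : lker w == 0%VS.
    apply/lker0P => u v eq_uv.
    by rewrite -[u]id_lfunE -[v]id_lfunE -w'w !comp_lfunE /= eq_uv.
  apply/lfunP => v; rewrite -{1}[v]id_lfunE -ww' comp_lfunE /=.
  exact: (lker0_lfunK w_inj).
apply/seteqP; split=> w.
  move=> [I [I1 _] [[Ww Nw] _]].
  have w0 : W0 f D Dg Pi w.
    apply/(W0P D_root_system Pi_base D_grading Dpos_compatible).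
    by split=> //; rewrite Nw => a [].
  split=> // a aPi.
  have [w' [Ww' w'w ww']] := weyl_inv D_root_system Ww.
  rewrite (invE _ _ w'w ww').
  have wK : w (w' a) = a by rewrite -comp_lfunE ww' id_lfunE.
  have Dw'a := weyl_root D_root_system Ww' (simple_root Pi_base aPi).
  have [i Di] := root_deg D_grading Dw'a.
  have [i_le1|] := boolP (i <= 1); first by exists i.
  rewrite -ltNge => i_gt1.
  have pos_of_gen b : deg_ge1 Dg b -> generated D (Dg 1 `\` I) b ->
      pos_roots D Pi (w b).
    move=> b_ge1 gen_b; have Pb := deg_ge1_pos_root Dpos_compatible b_ge1.
    case: (pos_root_or_opp D_root_system Pi_base
             (weyl_root D_root_system Ww (proj1 Pb))) => // neg.
    have : inversions (pos_roots D Pi) w b by [].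
    by rewrite Nw => -[].
  have w'a_ge1 : deg_ge1 Dg (w' a) by exists i => //=; lia.
  (* If [w' a] is not generated, [w] inverts it, although its image is the positive root [a]. If it
     is generated, its degree exceeds one, so it is a sum [b + c] of generated roots, and [a] would
     be the sum of the positive roots [w b] and [w c]. *)
  have [[k _]|not_gen] := pselect (generated D (Dg 1 `\` I) (w' a)); last first.
    have : inversions (pos_roots D Pi) w (w' a) by rewrite Nw.
    move=> [_]; rewrite wK => neg.
    have Pa := simple_pos_root Pi_base aPi.
    by case: (pos_root_not_opp D_root_system Pi_base Pa neg).
  have J1 : Dg 1 `\` I `<=` Dg 1 by move=> b [].
  case: k => [|k] /=.
    by move=> [D1 _]; have := deg_inj D_grading Di D1; lia.
  move=> [[b Jb [c Jc bcE]] _].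
  have Pwb : pos_roots D Pi (w b).
    by apply: pos_of_gen; [exists 1 => //; apply: J1 | exists 0%N].
  have Pwc : pos_roots D Pi (w c).
    apply: pos_of_gen; last by exists k.
    by exists k.+1%:Z => //=; apply: root_pow_deg Jc.
  have := simple_indecomposable D_root_system Pi_base Pwb Pwc.
  by rewrite -linearD /= bcE wK aPi.
move=> [w0 w_le1]; have [Ww N_ge1] :=
  (W0P D_root_system Pi_base D_grading Dpos_compatible w).1 w0.
have [w' [Ww' w'w ww']] := weyl_inv D_root_system Ww.
rewrite (invE _ _ w'w ww') in w_le1.
have w'K g : w' (w g) = g by rewrite -comp_lfunE w'w id_lfunE.
set I := inversions (pos_roots D Pi) w `&` Dg 1.
exists I.
  exact: (inversions_lower_ideal D_root_system Pi_base D_grading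
            Dpos_compatible).
have Nw : inversions (pos_roots D Pi) w =
    deg_ge1 Dg `\` generated D (Dg 1 `\` I).
  apply/seteqP; split=> g.
    move=> Ng; split; first exact: N_ge1.
    have [Pg Nwg] := Ng; have Dwg := weyl_root D_root_system Ww (proj1 Pg).
    move=> gen_g.
    suff Pwg : pos_roots D Pi (w g).
      by case: (pos_root_not_opp D_root_system Pi_base Pwg Nwg).
    (* Degree one roots outside [I] have positive images, so a generated root has a nonnegative
       one. *)
    split=> //; apply: generated_nonneg gen_g => b [D1b not_Ib].
    have Pb : pos_roots D Pi b.
      by apply: (deg_ge1_pos_root Dpos_compatible); exists 1.
    have [[] //|neg] := pos_root_or_opp D_root_system Pi_base
                          (weyl_root D_root_system Ww (proj1 Pb)).
    by case: not_Ib.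
  move=> [g_ge1 not_gen]; have Pg := deg_ge1_pos_root Dpos_compatible g_ge1.
  split=> //; have [Pwg|//] := pos_root_or_opp D_root_system Pi_base
                          (weyl_root D_root_system Ww (proj1 Pg)).
  have [k /= k_ge1 Dkg] := g_ge1; case: not_gen; rewrite -[g]w'K.
  apply: (pos_image_generated D_root_system Pi_base D_grading Ww Ww' ww'
            w_le1 Pwg k_ge1).
  by rewrite w'K.
split=> // u [Wu Nu].
apply: (weyl_inversions_inj D_root_system D_reduced Pi_base Ww Wu).
by rewrite Nw Nu.
Qed.
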